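(* Let $t$ and $p$ be positive integers, and write $t=pn+d$ with integers $n\geq 0$ and $1\leq d\leq p$. Then the largest size of a $(t,t+1,\ldots,t+p)$-core partition is \[ \max\Big\{\tbinom{n+2}{2}\lfloor\tfrac{d}{2}\rfloor\big(d-\lfloor\tfrac{d}{2}\rfloor\big)+\tbinom{n+2}{3}(p^2n+pd-p^2)-3\tbinom{n+2}{4}p^2,\; \tbinom{n+1}{2}\big(p-\lfloor\tfrac{p-d}{2}\rfloor\big)\big(d+\lfloor\tfrac{p-d}{2}\rfloor\big)+\tbinom{n+1}{3}(p^2n+pd-p^2)-3\tbinom{n+1}{4}p^2\Big\}. \] Moreover, the number of $(t,t+1,\ldots,t+p)$-core partitions attaining this largest size is at most $4$.
   Context: A partition is a finite weakly decreasing sequence $\lambda=(\lambda_1,\ldots,\lambda_r)$ of positive integers (the empty partition is allowed); its size is $|\lambda|=\sum_i\lambda_i$. In the Young diagram of $\lambda$ (row $i$ has $\lambda_i$ left-justified boxes), the hook length $h(i,j)$ of box $(i,j)$ is the number of boxes directly to its right, directly below it, plus the box itself. For a positive integer $t$, $\lambda$ is a $t$-core partition if none of its hook lengths is divisible by $t$; it is a $(t_1,\ldots,t_m)$-core partition if it is a $t_i$-core for every $i$. Binomial coefficients $\binom{a}{b}$ are $0$ when $a<b$; $\lfloor x\rfloor$ is the floor of $x$. *)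

(* Defs.v *)
From HB Require Import structures.
From mathcomp Require Import all_boot all_order all_algebra.

Set Implicit Arguments.
Unset Strict Implicit.
Unset Printing Implicit Defensive.

Definition is_partition (la : seq nat) : bool :=
  sorted geq la && all (fun x => 0 < x) la.

(* Rows and columns are numbered from 0, so (i, j) is a box of the Young
   diagram of la when i < size la and j < nth 0 la i.  The three summands are
   the boxes to the right, the boxes below, and the box itself. *)
Definition hook (la : seq nat) (i j : nat) : nat :=
  (nth 0 la i - j.+1) + count (fun x => j < x) (drop i.+1 la) + 1.

Definition is_core (t : nat) (la : seq nat) : Prop :=
  forall i j, i < size la -> j < nth 0 la i -> ~~ (t %| hook la i j).

Definition is_core_partition (ts : seq nat) (la : seq nat) : Prop :=
  is_partition la /\ (forall t, t \in ts -> is_core t la).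

Import GRing.Theory Num.Theory.
Local Open Scope ring_scope.

(* The formula is stated in int because p^2 n + p d - p^2 is negative
   for n = 0 and d < p. *)
Definition max_size1 (p n d : nat) : int :=
  'C(n + 2, 2)%:Z * (d %/ 2)%N%:Z * (d%:Z - (d %/ 2)%N%:Z)
  + 'C(n + 2, 3)%:Z * (p%:Z ^+ 2 * n%:Z + p%:Z * d%:Z - p%:Z ^+ 2)
  - 3 * 'C(n + 2, 4)%:Z * p%:Z ^+ 2.

(* For d <= p the truncated difference p - d is exact. *)
Definition max_size2 (p n d : nat) : int :=
  'C(n + 1, 2)%:Z * (p%:Z - ((p - d) %/ 2)%N%:Z) * (d%:Z + ((p - d) %/ 2)%N%:Z)
  + 'C(n + 1, 3)%:Z * (p%:Z ^+ 2 * n%:Z + p%:Z * d%:Z - p%:Z ^+ 2)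
  - 3 * 'C(n + 1, 4)%:Z * p%:Z ^+ 2.

(* Main.v *)
Require Import Defs.
From mathcomp Require Import all_boot all_order all_algebra zify ring.

(* A partition is a t'-core iff its set X of first-column hook lengths (beta)
   satisfies x - t' \in X for every x \in X with t' <= x; its size is the sum
   of X minus C(|X|, 2).  For a (t,...,t+p)-core, X avoids the semigroup
   generated by t,...,t+p, so X splits into rows k = x %/ (t + p), the k-th one
   inside the gap ](k (t + p)), (k+1) t[, and the row sizes a_k (the profile)
   satisfy a_(k+1) <= a_k - p, truncated.  Pushing each row to the right end of
   its gap can only increase the size, and stays admissible, so that only the
   profile matters.  If a_(k+1) < a_k - p, one may add a box to row k+1 or
   remove one from row k, and one of the two strictly increases the size; hence
   the optimal profiles are the staircases a_k = c - p k with c < t.  For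
   c = p q + r with 0 <= r <= p, the size is C(q+2,2) r (t - p q - r) plus a
   constant depending on q.  This is increasing in c as long as q < n - 1, and
   for q = n - 1 and q = n it is a concave parabola in r with at most two
   maximisers each. *)

Set Implicit Arguments.
Unset Strict Implicit.
Import GRing.Theory Num.Theory Order.TTheory.

(** * First-column hook lengths of a partition *)

Fixpoint beta (la : seq nat) : seq nat :=
  if la is l :: la' then l + size la' :: beta la' else [::].

Fixpoint unbeta (s : seq nat) : seq nat :=
  if s is x :: s' then x - size s' :: unbeta s' else [::].

Lemma size_beta la : size (beta la) = size la.
Proof. by elim: la => //= l la ->. Qed.

Lemma size_unbeta s : size (unbeta s) = size s.
Proof. by elim: s => //= x s ->. Qed.

Lemma sumn_beta la : sumn (beta la) = sumn la + 'C(size la, 2).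
Proof. by elim: la => //= l la ->; rewrite binS bin1; lia. Qed.

Lemma geq_trans : transitive geq.
Proof. by move=> y x z /= le_yx le_zy; apply: leq_trans le_zy le_yx. Qed.

Lemma gtn_trans : transitive gtn.
Proof. by move=> y x z /= lt_yx lt_zy; apply: ltn_trans lt_zy lt_yx. Qed.

Lemma path_geq_all l (la : seq nat) : path geq l la -> {in la, forall x, x <= l}.
Proof. by move=> /(order_path_min geq_trans)/allP. Qed.

Lemma beta_lt l la : path geq l la -> {in beta la, forall x, x < l + size la}.
Proof.
elim: la l => //= m la IH l /andP[le_ml pla] x; rewrite inE => /predU1P[->|].
  by move: le_ml => /=; lia.
by move=> /(IH _ pla); move: le_ml => /=; lia.
Qed.

Lemma beta_inj : injective beta.
Proof.
elim=> [|l la IH] [|m mu] //= [eq_lm /[dup] /IH eq_la _].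
by move: eq_lm; rewrite eq_la => /addIn ->.
Qed.

Lemma sorted_beta la : sorted geq la -> sorted gtn (beta la).
Proof.
elim: la => //= l la IH pla; rewrite path_sortedE; last exact: gtn_trans.
by rewrite IH ?(path_sorted pla) // andbT; apply/allP => x /(beta_lt pla).
Qed.

Lemma beta_gt0 la : is_partition la -> 0 \notin beta la.
Proof.
case/andP=> _; elim: la => //= l la IH /andP[l_gt0 /IH]; rewrite inE negb_or.
by move=> ->; rewrite andbT; lia.
Qed.

Lemma count_leq_gt j la :
  count (fun x => x <= j) la + count (fun x => j < x) la = size la.
Proof.
rewrite -(count_predC (fun x => x <= j) la); congr (_ + _).
by apply: eq_count => x /=; rewrite ltnNge.
Qed.

Lemma count_leq_all j (la : seq nat) : {in la, forall x, x <= j} ->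
  count (fun x => x <= j) la = size la.
Proof. by move=> h; apply/eqP; rewrite -all_count; apply/allP. Qed.

(** Number the steps of the boundary of the diagram from the bottom left: vertical steps carry the
    numbers in [beta la], and the horizontal step of column j comes after j horizontal ones and one
    vertical step per part at most j. *)
Lemma beta_gapP la y : sorted geq la ->
  reflect (exists j, y = j + count (fun x => x <= j) la) (y \notin beta la).
Proof.
elim: la y => [|l la IH] y.
  by move=> _; apply: (iffP idP) => // _; exists y; rewrite addn0.
move=> /= pla; have sla := path_sorted pla; rewrite inE negb_or.
apply: (iffP andP) => [[y_neq /IH-/(_ sla)[j def_y]]|[j ->]].
  have [lt_jl|le_lj] := ltnP j l; first by exists j; rewrite leqNgt lt_jl.
  (* From l on every part is counted, so adding the part l turns the gap of column j into that of
     column j - 1. *)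
  have cj i : l <= i -> count (fun x => x <= i) la = size la.
    by move=> le_li; apply: count_leq_all => x /(path_geq_all pla); lia.
  by rewrite cj // in def_y; exists j.-1; rewrite cj; lia.
have [lt_jl|le_lj] := ltnP j l.
  split; last by apply/IH => //; exists j.
  by have := count_leq_gt j la; lia.
rewrite count_leq_all => [|x /(path_geq_all pla)]; last by lia.
rewrite add1n; split; first by lia.
by apply/negP => /(beta_lt pla); lia.
Qed.

(** The hook of box (i, j) is x - y, with x the i-th entry of [beta la] and y the gap of column j;
    the gaps below x are those of the columns meeting row i. *)
Lemma is_coreP t la : sorted geq la ->
  is_core t la <->
  {in beta la, forall x y, y < x -> y \notin beta la -> ~~ (t %| x - y)}.
Proof.
elim: la => [|l la IH] //= pla; have sla := path_sorted pla.
have hook0 j : j < l -> hook (l :: la) 0 j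
    = l + size la - (j + count (fun x => x <= j) la).
  by rewrite /hook /= drop0; have := count_leq_gt j la; lia.
split=> [core_la x | core_la [|i] j /= lt_i lt_j].
- rewrite inE => /predU1P[->|x_la] y lt_yx; rewrite inE negb_or => /andP[_ y_la].
    have [j def_y] := beta_gapP y sla y_la.
    have lt_jl : j < l.
      rewrite ltnNge; apply/negP => le_lj.
      rewrite count_leq_all in def_y => [|z /(path_geq_all pla)]; lia.
    by have := core_la 0 j isT lt_jl; rewrite hook0 // -def_y.
  have /IH : is_core t la by move=> i j lt_i; apply: (core_la i.+1).
  by move=> /(_ sla x x_la y lt_yx y_la).
- rewrite hook0 //; apply: core_la; first exact: mem_head.
    by have := count_leq_gt j la; lia.
  rewrite inE negb_or; apply/andP; split; first by have := count_leq_gt j la; lia.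
  by apply/beta_gapP => //; exists j.
- have : is_core t la; last by move/(_ i j lt_i lt_j).
  apply/IH => // x x_la y lt_yx y_la; apply: core_la => //.
    by rewrite inE x_la orbT.
  by rewrite inE negb_or y_la andbT; have := beta_lt pla x_la; lia.
Qed.

(** Closure is the case y = x - t. Conversely, if t divides x - y, closure carries membership from x
    down to the gap y in steps of t. *)
Lemma is_core_closedP t la : 0 < t -> is_partition la ->
  is_core t la <-> {in beta la, forall x, t <= x -> x - t \in beta la}.
Proof.
move=> t_gt0 part_la; have /andP[sla _] := part_la.
split=> [/(is_coreP _ sla) core_la x x_la le_tx | closed_la].
  apply: contraT => /(core_la x x_la _).
  by rewrite subKn // dvdnn; move=> h; apply: h; lia.
apply/is_coreP => // x x_la y lt_yx; apply: contra => /dvdnP[q].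
elim: q x x_la lt_yx => [|q IH] x x_la lt_yx; first by lia.
rewrite mulSn => def_x; have x_t : x - t \in beta la by apply: closed_la => //; lia.
have [lt_y|] := ltnP y (x - t); first by apply: IH x_t lt_y _; lia.
by move=> le_y; have <- : x - t = y by lia.
Qed.

Lemma path_gtn_size x (s : seq nat) : path gtn x s -> 0 \notin s -> 0 < x -> size s < x.
Proof.
elim: s x => //= y s IH x /andP[lt_yx ps]; rewrite inE negb_or => /andP[y0 s0] _.
by have := IH y ps s0; move: lt_yx => /=; lia.
Qed.

Lemma unbetaK s : sorted gtn s -> 0 \notin s -> beta (unbeta s) = s.
Proof.
elim: s => //= x s IH ps; rewrite inE negb_or => /andP[x0 s0].
rewrite IH ?(path_sorted ps) // size_unbeta subnK //.
by apply: ltnW; apply: path_gtn_size => //; lia.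
Qed.

Lemma is_partition_unbeta s :
  sorted gtn s -> 0 \notin s -> is_partition (unbeta s).
Proof.
elim: s => //= x s IH ps; rewrite inE negb_or => /andP[x0 s0].
have /andP[sps pos] := IH (path_sorted ps) s0.
have lt_x : size s < x by apply: path_gtn_size => //; lia.
rewrite /is_partition /= pos andbT; apply/andP; split; last by lia.
case: s ps {IH s0 pos} sps lt_x => //= y s /andP[/= lt_yx _] -> lt_x.
by rewrite andbT; lia.
Qed.

(** The interval N - 1, ..., N - |s| has sum |s| N - C(|s| + 1, 2). Removing the largest entry x
    leaves a list below x, to which induction applies. *)
Lemma sumn_leq_right_interval N (s : seq nat) : sorted gtn s -> {in s, forall x, x < N} ->
  sumn s + 'C((size s).+1, 2) <= size s * N
    ?= iff (s == rev (iota (N - size s) (size s))).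
Proof.
elim: s N => [|x s IH] N /=; first by move=> _ _; split; rewrite ?eqxx.
move=> ps lt_N; have lt_xN : x < N by apply: lt_N; rewrite mem_head.
have lt_s : {in s, forall y, y < x}.
  by apply/allP; apply: order_path_min ps; apply: gtn_trans.
have [le_s eq_s] := IH x (path_sorted ps) lt_s.
have size_s : size s <= x.
  have := uniq_leq_size (sorted_uniq gtn_trans ltnn (path_sorted ps)) (s2 := iota 0 x).
  by rewrite size_iota; apply => y /lt_s; rewrite mem_iota add0n.
have lem : (size s).+1 * N = (size s) * x + x + (size s).+1 + (size s).+1 * (N - x.+1).
  by rewrite -{1}(subnK lt_xN); ring.
rewrite binS bin1; split; first by rewrite lem; lia.
have -> : rev (iota (N - (size s).+1) (size s).+1)
    = N.-1 :: rev (iota (N.-1 - size s) (size s)).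
  have -> : (size s).+1 = size s + 1 by lia.
  rewrite iotaD rev_cat /=; congr cons; first by lia.
  by congr (rev (iota _ _)); lia.
rewrite eqseq_cons lem.
have [lt_x|] := ltnP x.+1 N.
  have -> : (x == N.-1) = false by lia.
  have gap_gt0 : 0 < (size s).+1 * (N - x.+1) by rewrite muln_gt0 subn_gt0.
  by rewrite ltn_eqF //; lia.
move=> le_Nx; have def_N : N = x.+1 by lia.
rewrite def_N /= eqxx subnn muln0 -eq_s; apply/eqP/eqP; lia.
Qed.

(** * Profiles and the sizes they determine *)

Definition row_weight (t k m : nat) : int :=
  ((m * (k.+1 * t))%:Z - 'C(m.+1, 2)%:Z)%R.

(** [row_weight t k m] sums the m integers just below (k + 1) t, so this is the size of a partition
    whose beta set has [a k] elements in each row k <= n, all pushed right. *)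
Definition profile_size (t n : nat) (a : nat -> nat) : int :=
  (\sum_(k < n.+1) row_weight t k (a k) - 'C(\sum_(k < n.+1) a k, 2)%:Z)%R.

Definition profile (t p : nat) (a : nat -> nat) : Prop :=
  a 0 < t /\ forall k, a k.+1 <= a k - p.

Definition staircase (p c k : nat) : nat := c - p * k.

Lemma eq_profile_size t n a a' : (forall k, k <= n -> a k = a' k) ->
  profile_size t n a = profile_size t n a'.
Proof.
move=> eq_a; rewrite /profile_size; congr (_ - 'C(_, 2)%:Z)%R; apply: eq_bigr => k _.
  by rewrite eq_a // -ltnS.
by rewrite eq_a // -ltnS.
Qed.

Lemma profile_bound t p a k : profile t p a -> a k + p * k < t \/ a k = 0.
Proof.
case=> a0 aS; elim: k => [|k IH]; first by left; lia.
by have := aS k; rewrite mulnS; lia.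
Qed.

Lemma row_weightS t k m :
  row_weight t k m.+1 = (row_weight t k m + ((k.+1 * t)%:Z - m.+1%:Z))%R.
Proof. by rewrite /row_weight [in LHS]binS bin1 mulSn; lia. Qed.

(** The new element of row k is (k + 1) t - (a k + 1), and one more element raises C(S, 2) by S. *)
Lemma profile_sizeS t n a k : k < n.+1 ->
  profile_size t n (fun i => a i + (i == k)) =
  (profile_size t n a
   + ((k.+1 * t)%:Z - (a k).+1%:Z - (\sum_(i < n.+1) a i)%N%:Z))%R.
Proof.
move=> lt_kn.
have neq_k (i : 'I_n.+1) : i != Ordinal lt_kn -> (i == k :> nat) = false.
  by move=> ne_ik; apply: negbTE.
have sum_up : \sum_(i < n.+1) (a i + (i == k :> nat)) = (\sum_(i < n.+1) a i).+1.
  rewrite big_split -[RHS]addn1 /=; congr (_ + _).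
  by rewrite (bigD1 (Ordinal lt_kn)) //= eqxx big1 // => i /neq_k ->.
rewrite /profile_size sum_up binS bin1.
rewrite (bigD1 (Ordinal lt_kn)) //= [in RHS](bigD1 (Ordinal lt_kn)) //= eqxx.
rewrite addn1 row_weightS.
under eq_bigr => i ne_ik do rewrite neq_k // addn0.
by rewrite PoszD; ring.
Qed.

(* The two gains add up to [t - 2 + a k - a k.+1 > 0]. *)
Lemma profile_improve t p n a k : 0 < t -> 0 < p -> profile t p a ->
  a k.+1 < a k - p -> k < n ->
  exists2 a', profile t p a' & (profile_size t n a < profile_size t n a')%R.
Proof.
move=> t_gt0 p_gt0 [a0 aS] defect lt_kn.
have lt_kn1 : k < n.+1 by lia.
pose up i := a i + (i == k.+1); pose down i := a i - (i == k).
have Eup := @profile_sizeS t n a k.+1 lt_kn.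
have Edown := @profile_sizeS t n down k lt_kn1.
have downK : profile_size t n (fun i => down i + (i == k)) = profile_size t n a.
  have dK i : down i + (i == k) = a i by rewrite /down; case: eqP => [->|]; lia.
  exact: eq_profile_size.
have sum_down : \sum_(i < n.+1) a i = (\sum_(i < n.+1) down i).+1.
  rewrite (bigD1 (Ordinal lt_kn1)) //= [in RHS](bigD1 (Ordinal lt_kn1)) //=.
  rewrite /down eqxx -addSn; congr (_ + _); first by lia.
  apply: eq_bigr => i ne_ik; rewrite (_ : (i == k :> nat) = false) ?subn0 //.
  exact: negbTE.
have down_k : down k = (a k).-1 by rewrite /down eqxx subn1.
rewrite downK down_k in Edown.
have [gain|gain] := ltP (profile_size t n a) (profile_size t n up).
  exists up => //; split=> [|i]; first by rewrite /up addn0.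
  have := aS i; rewrite /up eqSS; case: (i =P k) => [->|]; last by lia.
  by rewrite (_ : (k == k.+1) = false); lia.
exists down; last by move: Eup Edown gain; rewrite -/up sum_down mulSn; lia.
split=> [|i]; first by rewrite /down; lia.
by have := aS i; rewrite /down; case: (i =P k) => [->|]; lia.
Qed.

(** A crude bound, which makes repeated use of [profile_improve] terminate. *)
Lemma profile_size_bound t p n a : profile t p a ->
  (profile_size t n a <= (n.+1 * (t * (n.+1 * t)))%:Z)%R.
Proof.
move=> prof.
have le_row k : k < n.+1 -> (row_weight t k (a k) <= (t * (n.+1 * t))%:Z)%R.
  move=> lt_kn; have le_a : a k <= t by have := profile_bound k prof; lia.
  have : a k * (k.+1 * t) <= t * (n.+1 * t).
    by apply: leq_mul => //; apply: leq_mul.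
  by rewrite /row_weight; lia.
have : (\sum_(k < n.+1) row_weight t k (a k) <= \sum_(k < n.+1) (t * (n.+1 * t))%:Z)%R.
  by apply: ler_sum => k _; apply: le_row.
rewrite sumr_const card_ord -mulr_natl natz /profile_size; lia.
Qed.

(** Induction on the distance to the bound of [profile_size_bound]: either some row k < n has a
    defect and the profile can be improved, or there is none and the profile is a staircase. *)
Lemma profile_staircase t p n a : 0 < t -> 0 < p -> t <= p * n.+1 -> profile t p a ->
  a =1 staircase p (a 0) \/
  exists2 c, c < t & (profile_size t n a < profile_size t n (staircase p c))%R.
Proof.
move=> t_gt0 p_gt0 le_t.
have [N] := ubnP `|((n.+1 * (t * (n.+1 * t)))%:Z - profile_size t n a)%R|%N.
elim: N a => // N IH a lt_N prof.
have [/existsP[k defect]|no_defect] := boolP [exists k : 'I_n, a k.+1 < a k - p].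
  have [a' prof' gain] := profile_improve t_gt0 p_gt0 prof defect (ltn_ord k).
  have bound' := @profile_size_bound t p n a' prof'.
  right; have [|eq_a'|[c lt_c gain']] := IH a' _ prof'; first by lia.
    exists (a' 0); first by case: prof'.
    by rewrite -(eq_profile_size t (fun k (_ : k <= n) => eq_a' k)).
  by exists c => //; apply: lt_trans gain gain'.
left=> k; rewrite /staircase; elim: k => [|k IHk]; first by lia.
have [a0 aS] := prof; have := aS k.
have [lt_kn|le_nk] := ltnP k n.
  move: no_defect; rewrite negb_exists => /forallP/(_ (Ordinal lt_kn)) /=.
  by rewrite mulnS; lia.
(* Since [a 0] < t <= p (n + 1), row k + 1 is empty in both profiles once k >= n. *)
have : p * n <= p * k by rewrite leq_mul2l le_nk orbT.
by move: le_t; rewrite !mulnS; lia.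
Qed.

(** * The size of a staircase in closed form *)

Lemma bin2_int (m : nat) : ('C(m, 2)%:Z * 2 = m%:Z * (m%:Z - 1))%R.
Proof. by have := mul_bin_left m 1; rewrite bin1; case: m => [|m] //; nia. Qed.

Lemma bin3_int (m : nat) : ('C(m, 3)%:Z * 6 = m%:Z * (m%:Z - 1) * (m%:Z - 2))%R.
Proof.
have := bin2_int m; have := mul_bin_left m 2.
by case: m => [|[|m]] //; rewrite !subSS subn0; nia.
Qed.

Lemma bin4_int (m : nat) :
  ('C(m, 4)%:Z * 24 = m%:Z * (m%:Z - 1) * (m%:Z - 2) * (m%:Z - 3))%R.
Proof.
have := bin3_int m; have := mul_bin_left m 3.
by case: m => [|[|[|m]]] //; rewrite !subSS subn0; nia.
Qed.

(** The profile size of the staircase with c = p q, when q <= n. For t = p n + d the factor p (t -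
    p) equals p^2 n + p d - p^2. *)
Definition staircase_base (t p q : nat) : int :=
  ('C(q + 2, 3)%:Z * (p%:Z * (t%:Z - p%:Z)) - 3 * 'C(q + 2, 4)%:Z * p%:Z ^+ 2)%R.

(** Row q - k has p k + r elements, and rows beyond q are empty. A general [F] serves both the
    weights and the number of elements. *)
Lemma sum_staircase (R : nmodType) p q n r (F : nat -> nat -> R) :
    (forall k, F k 0 = 0%R) -> r <= p -> q <= n ->
  (\sum_(k < n.+1) F k (staircase p (p * q + r) k)
   = \sum_(k < q.+1) F (q - k)%N (p * k + r)%N)%R.
Proof.
move=> F0 le_rp le_qn.
rewrite -(big_mkord xpredT (fun k => F k (staircase p (p * q + r) k))).
rewrite (big_cat_nat (n := q.+1)) //=.
rewrite [X in (_ + X)%R]big_nat_cond [X in (_ + X)%R]big1 ?addr0; last first.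
  move=> k /andP[/andP[lt_qk _] _]; rewrite /staircase.
  have -> : p * q + r - p * k = 0; last by [].
  by have : p * q.+1 <= p * k; [rewrite leq_mul2l lt_qk orbT | rewrite mulnS; lia].
rewrite big_mkord (reindex_inj rev_ord_inj) /=; apply: eq_bigr => k _.
rewrite subSS; congr (F _ _); rewrite /staircase mulnBr.
have : p * k <= p * q; last by lia.
by rewrite leq_mul2l -ltnS ltn_ord orbT.
Qed.

(** Keeping u apart from m lets the induction add rows without changing the earlier terms. The
    factor 12 clears the denominators. *)
Lemma sum_row_weight t p r u m : m <= u.+1 ->
  ((\sum_(k < m) row_weight t (u - k) (p * k + r)) * 12
  = 12 * t%:Z * r%:Z * u.+1%:Z * m%:Z
    + 6 * t%:Z * (p%:Z * u.+1%:Z - r%:Z) * m%:Z * (m%:Z - 1)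
    - 2 * t%:Z * p%:Z * m%:Z * (m%:Z - 1) * (2 * m%:Z - 1)
    - p%:Z ^+ 2 * m%:Z * (m%:Z - 1) * (2 * m%:Z - 1)
    - 3 * p%:Z * (2 * r%:Z + 1) * m%:Z * (m%:Z - 1)
    - 6 * r%:Z * (r%:Z + 1) * m%:Z)%R.
Proof.
elim: m => [|m IH] le_mu; first by rewrite big_ord0; ring.
rewrite big_ord_recr /= mulrDl IH; last by lia.
have bin12 : ('C((p * m + r).+1, 2)%:Z * 12
    = (p * m + r).+1%:Z * ((p * m + r).+1%:Z - 1) * 6)%R.
  by rewrite -bin2_int; ring.
rewrite /row_weight mulrBl bin12 !intS !PoszM !intS !PoszD PoszM.
have -> : ((u - m)%N%:Z = u%:Z - m%:Z)%R by lia.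
by ring.
Qed.

Lemma staircase_size t p q n r : r <= p -> q <= n ->
  (profile_size t n (staircase p (p * q + r))
  = 'C(q + 2, 2)%:Z * r%:Z * (t%:Z - p%:Z * q%:Z - r%:Z)
    + staircase_base t p q)%R.
Proof.
move=> le_rp le_qn; rewrite /profile_size.
rewrite (@sum_staircase _ p q n r (row_weight t)) //.
have -> : \sum_(k < n.+1) staircase p (p * q + r) k = q.+1 * r + p * 'C(q.+1, 2).
  transitivity (\sum_(k < q.+1) (p * k + r)).
    exact: (@sum_staircase nat p q n r (fun _ m => m)).
  rewrite big_split /= sum_nat_const card_ord -big_distrr /= addnC; congr (_ + p * _).
  by rewrite -bin2_sum big_mkord.
have sumE := @sum_row_weight t p r q q.+1 (leqnn _).
set W := (\sum_(k < _) _)%R in sumE *; set S := q.+1 * r + _.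
have S2 : (S%:Z * 2 = 2 * q.+1%:Z * r%:Z + p%:Z * (q.+1%:Z * (q.+1%:Z - 1)))%R.
  by rewrite -bin2_int /S PoszD !PoszM; ring.
(* 24 is the denominator of C(q + 2, 4) as a polynomial in q. *)
apply: (@mulIf _ 24%R) => //; rewrite /staircase_base.
transitivity (W * 12 * 2 - 3 * (S%:Z * 2) ^+ 2 + 6 * (S%:Z * 2))%R.
  by have := bin2_int S; move: ('C(S, 2)%:Z)%R => b bE; lia.
transitivity ('C(q + 2, 2)%:Z * 2 * 12 * r%:Z * (t%:Z - p%:Z * q%:Z - r%:Z)
  + 'C(q + 2, 3)%:Z * 6 * 4 * (p%:Z * (t%:Z - p%:Z))
  - 3 * ('C(q + 2, 4)%:Z * 24) * p%:Z ^+ 2)%R; last by ring.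
rewrite sumE S2 bin2_int bin3_int bin4_int PoszD intS.
ring.
Qed.

(** * Maximising over the staircases *)

Lemma between_consecutive (u v x : int) : (0 <= u - v <= 1)%R ->
  (0 <= (u - x) * (v - x))%R /\ ((u - x) * (v - x) = 0 -> x = u \/ x = v)%R.
Proof.
move=> uv; split; last by move=> /eqP; rewrite mulf_eq0 => /orP[]; lia.
have [le_xv|lt_vx] := leP x v; first by rewrite mulr_ge0; lia.
by rewrite mulr_le0; lia.
Qed.

(** Both quotient q with remainder p and quotient q + 1 with remainder 0 describe c = p (q + 1); the
    increment comes from equating the two sizes. *)
Lemma staircase_baseS t p q :
  (staircase_base t p q.+1 = staircase_base t p q
    + 'C(q + 2, 2)%:Z * p%:Z * (t%:Z - p%:Z * q%:Z - p%:Z))%R.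
Proof.
have := @staircase_size t p q.+1 q.+1 0 (leq0n _) (leqnn _).
have := @staircase_size t p q q.+1 p (leqnn _) (leqnSn _).
by rewrite addn0 mulnS addnC => ->; rewrite mulr0 mul0r add0r addrC.
Qed.

Lemma staircase_base_le t p n q : p * n <= t -> q <= n ->
  (staircase_base t p q <= staircase_base t p n)%R.
Proof.
elim: n => [|n IH] le_t le_qn; first by have -> : q = 0 by lia.
have [->//|ne_q] := eqVneq q n.+1.
apply: le_trans (IH _ _) _; [by move: le_t; rewrite mulnS; lia | by lia |].
rewrite staircase_baseS lerDl !mulr_ge0 //.
by move: le_t; rewrite mulnS; lia.
Qed.

Lemma max_size1E p n d :
  (max_size1 p n d = 'C(n + 2, 2)%:Z * (d %/ 2)%N%:Z * (d%:Z - (d %/ 2)%N%:Z)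
    + staircase_base (p * n + d) p n)%R.
Proof. by rewrite /max_size1 /staircase_base PoszD PoszM; ring. Qed.

(** For quotient n the parabola is r (p + d - r). When d <= p, the two factors are the halves of p +
    d, rounded up and down. *)
Lemma max_size2E p n d :
  (max_size2 p n.+1 d =
    'C(n + 2, 2)%:Z * (p%:Z - ((p - d) %/ 2)%N%:Z) * (d%:Z + ((p - d) %/ 2)%N%:Z)
    + staircase_base (p * n.+1 + d) p n)%R.
Proof.
by rewrite /max_size2 /staircase_base PoszD PoszM addSnnS; ring.
Qed.

(* For n = 0 the last two entries are junk and need not attain the maximum. *)
Definition maximisers (p n d : nat) : seq nat :=
  [:: p * n + d %/ 2; p * n + (d - d %/ 2);
      p * n - (p - d) %/ 2; p * n.-1 + (d + (p - d) %/ 2)].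

Lemma bin2_gt0 q : (0 < 'C(q + 2, 2)%:Z)%R.
Proof. by rewrite ltz_nat bin_gt0; lia. Qed.

Lemma staircase_max t p n d c : 0 < p -> d <= p -> t = p * n + d -> c < t ->
  let M := Num.max (max_size1 p n d) (max_size2 p n d) in
  let size_c := profile_size t n (staircase p c) in
  (size_c <= M)%R /\ (size_c = M -> c \in maximisers p n d).
Proof.
move=> p_gt0 le_dp def_t lt_ct M size_c.
have def_c : c = p * (c %/ p) + c %% p by rewrite mulnC -divn_eq.
have lt_r : c %% p < p by rewrite ltn_pmod.
have le_qn : c %/ p <= n.
  by rewrite -ltnS ltn_divLR // mulSnr mulnC; lia.
move: def_c lt_r le_qn; move: (c %/ p) (c %% p) => q r def_c lt_r le_qn.
have size_cE := @staircase_size t p q n r (ltnW lt_r) le_qn.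
rewrite -def_c -/size_c in size_cE.
have [le_M1 le_M2] : (max_size1 p n d <= M /\ max_size2 p n d <= M)%R.
  by rewrite /M !le_max !lexx orbT.
have bin_pos := bin2_gt0.
have [eq_qn|ne_qn] := eqVneq q n.
  (* For u + v = d one has u v - r (d - r) = (u - r) (v - r): this product is the shortfall from the
     top of the parabola, and it vanishes only at the two rounded halves of d. *)
  have [] := @between_consecutive (d%:Z - (d %/ 2)%N%:Z) (d %/ 2)%N%:Z r%:Z.
    by lia.
  set prod := (_ * _)%R => prod_ge0 prod_eq0.
  have E : (max_size1 p n d = size_c + 'C(n + 2, 2)%:Z * prod)%R.
    by rewrite max_size1E size_cE eq_qn -def_t def_t /prod PoszD PoszM; ring.
  have gap_ge0 : (0 <= 'C(n + 2, 2)%:Z * prod)%R by rewrite mulr_ge0 // ltW.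
  split=> [|eq_M]; first by lia.
  have /eqP : ('C(n + 2, 2)%:Z * prod = 0)%R by lia.
  rewrite mulf_eq0 (gt_eqF (bin_pos n)) /= => /eqP /prod_eq0 r_eq.
  by rewrite def_c eq_qn !inE; lia.
case: n => [|n] in def_t M size_c le_qn size_cE le_M1 le_M2 ne_qn *; first by lia.
have [eq_qn|ne_qn'] := eqVneq q n.
  have [] := @between_consecutive (p%:Z - ((p - d) %/ 2)%N%:Z)
      (d%:Z + ((p - d) %/ 2)%N%:Z) r%:Z.
    by lia.
  set prod := (_ * _)%R => prod_ge0 prod_eq0.
  have E : (max_size2 p n.+1 d = size_c + 'C(n + 2, 2)%:Z * prod)%R.
    by rewrite max_size2E size_cE eq_qn -def_t def_t /prod PoszD PoszM intS; ring.
  have gap_ge0 : (0 <= 'C(n + 2, 2)%:Z * prod)%R by rewrite mulr_ge0 // ltW.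
  split=> [|eq_M]; first by lia.
  have /eqP : ('C(n + 2, 2)%:Z * prod = 0)%R by lia.
  rewrite mulf_eq0 (gt_eqF (bin_pos n)) /= => /eqP /prod_eq0 r_eq.
  by rewrite def_c eq_qn !inE /= mulnS; lia.
(* Here q < n, the original n being n + 1. Raising c to p (q + 1) strictly increases the size,
   [staircase_base] does not decrease from q + 1 to n, and [max_size2] is at least its value at
   n. *)
suff lt_M2 : (size_c < max_size2 p n.+1 d)%R by split; [|move=> eq_M]; lia.
have le_base : (staircase_base t p q.+1 <= staircase_base t p n)%R.
  by apply: staircase_base_le; [rewrite def_t mulnS | ]; lia.
have -> : (size_c = staircase_base t p q.+1 -
    'C(q + 2, 2)%:Z * ((p%:Z - r%:Z) * (t%:Z - p%:Z * q%:Z - p%:Z - r%:Z)))%R.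
  by rewrite staircase_baseS size_cE; ring.
have gap_gt0 :
    (0 < 'C(q + 2, 2)%:Z * ((p%:Z - r%:Z) * (t%:Z - p%:Z * q%:Z - p%:Z - r%:Z)))%R.
  have : p * (q + 2) <= p * n.+1 by rewrite leq_mul2l; lia.
  by rewrite mulnDr => le_pq; rewrite !mulr_gt0 //; lia.
rewrite max_size2E -def_t.
have : (0 <= 'C(n + 2, 2)%:Z * (p%:Z - ((p - d) %/ 2)%N%:Z)
    * (d%:Z + ((p - d) %/ 2)%N%:Z))%R.
  by rewrite !mulr_ge0 //; lia.
by lia.
Qed.

Lemma staircase_max_attained t p n d :
    0 < p -> 0 < d -> d <= p -> t = p * n + d ->
  exists2 c, c < t & profile_size t n (staircase p c)
    = Num.max (max_size1 p n d) (max_size2 p n d).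
Proof.
move=> p_gt0 d_gt0 le_dp def_t.
have size1 : profile_size t n (staircase p (p * n + d %/ 2)) = max_size1 p n d.
  rewrite staircase_size //; last by lia.
  by rewrite max_size1E -def_t def_t PoszD PoszM; ring.
case: leP => [le_12|lt_21]; last by exists (p * n + d %/ 2) => //; lia.
case: n => [|n] in def_t size1 le_12 *.
  (* For n = 0 the second value is 0 and the first is nonnegative, so in this case they agree and
     the witness of the first serves. *)
  exists (p * 0 + d %/ 2); first by lia.
  apply: le_anti; rewrite size1 le_12 /=.
  have -> : max_size2 p 0 d = 0%R by rewrite /max_size2 !bin_small //; ring.
  have base0 : staircase_base (p * 0 + d) p 0 = 0%R.
    by rewrite /staircase_base !bin_small //; ring.
  by rewrite max_size1E base0 addr0 !mulr_ge0 //; lia.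
exists (p * n + (p - (p - d) %/ 2)); first by rewrite def_t mulnS; lia.
rewrite staircase_size; [|by lia|by lia].
rewrite max_size2E -def_t -subzn; last by lia.
by rewrite def_t PoszD PoszM intS; ring.
Qed.

(** * Rows of the beta set of a core *)

Definition core_set (t p : nat) (X : seq nat) : Prop :=
  [/\ sorted gtn X, 0 \notin X
    & forall x i, x \in X -> i <= p -> t + i <= x -> x - (t + i) \in X].

Definition row (T k : nat) (X : seq nat) : seq nat := [seq x <- X | x %/ T == k].

Lemma core_partitionP t p la : 0 < t ->
  is_core_partition (iota t p.+1) la <->
  is_partition la /\ core_set t p (beta la).
Proof.
move=> t_gt0; split=> [[part_la core_la]|[part_la [_ _ closed_la]]].
  have /andP[sla _] := part_la.
  split=> //; split=> [||x i x_la le_ip]; [exact: sorted_beta|exact: beta_gt0|].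
  have core_ti : is_core (t + i) la by apply: core_la; rewrite mem_iota; lia.
  have [closed_la _] := @is_core_closedP (t + i) la ltac:(lia) part_la.
  exact: closed_la core_ti x x_la.
split=> // t'; rewrite mem_iota => /andP[le_tt' lt_t'].
apply/is_core_closedP => // [|x x_la]; first by lia.
by have := closed_la x (t' - t) x_la; rewrite subnKC //; apply; lia.
Qed.

(** Subtracting t + min(i, p) passes from k to k - 1, as i - min(i, p) <= (k - 1) p; the descent
    ends at 0, which is not in X. *)
Lemma core_set_semigroup t p X k i : core_set t p X ->
  i <= k * p -> k * t + i \notin X.
Proof.
case=> _ X0 closedX; elim: k i => [|k IH] i.
  by rewrite mul0n leqn0 => /eqP ->; rewrite mul0n.
rewrite !mulSn => le_i; apply/negP => x_X.
have := closedX _ (minn i p) x_X (geq_minr _ _).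
have -> : t + k * t + i - (t + minn i p) = k * t + (i - minn i p) by lia.
by rewrite (negPf (IH _ _)); lia.
Qed.

(** With k the quotient of x, all numbers from (k + 1) t to (k + 1) (t + p) are in the semigroup
    generated by t, ..., t + p. *)
Lemma core_set_lt t p X x : 0 < t -> core_set t p X ->
  x \in X -> x < (x %/ (t + p)).+1 * t.
Proof.
move=> t_gt0 coreX x_X; rewrite ltnNge; apply/negP => le_x.
have lt_x : x < (x %/ (t + p)).+1 * (t + p) by rewrite ltn_ceil // addn_gt0 t_gt0.
rewrite mulnDr in lt_x.
have := @core_set_semigroup t p X (x %/ (t + p)).+1 (x - (x %/ (t + p)).+1 * t) coreX.
by rewrite subnKC // x_X => /(_ ltac:(lia)).
Qed.

Lemma core_set_row_le t p n X x : 0 < t -> t <= p * n.+1 -> core_set t p X ->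
  x \in X -> x %/ (t + p) <= n.
Proof.
move=> t_gt0 le_t coreX x_X; have lt_x := core_set_lt t_gt0 coreX x_X.
have le_x := leq_trunc_div x (t + p).
have : x %/ (t + p) * p < n.+1 * p.
  by move: lt_x le_x le_t; rewrite mulnDr mulSn (mulnC p); lia.
by rewrite ltn_mul2r ltnS => /andP[].
Qed.

Lemma sorted_row T k X : sorted gtn X -> sorted gtn (row T k X).
Proof. by apply: sorted_filter; apply: gtn_trans. Qed.

Lemma sorted_gtn_uniq (X : seq nat) : sorted gtn X -> uniq X.
Proof. by apply: sorted_uniq; [exact: gtn_trans | exact: ltnn]. Qed.

(** Subtracting t + p maps row k + 1 injectively into row k. Its largest element x yields p more
    elements above these images: x - (t + p) + i = x - (t + (p - i)) for 1 <= i <= p. *)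
Lemma core_set_row_shrink t p X k : 0 < t -> core_set t p X ->
  size (row (t + p) k.+1 X) <= size (row (t + p) k X) - p.
Proof.
move=> t_gt0 coreX; have [sX X0 closedX] := coreX.
have T_gt0 : 0 < t + p by rewrite addn_gt0 t_gt0.
case def_row: (row (t + p) k.+1 X) => [|x s] //.
have row_facts y : y \in x :: s ->
    [/\ y \in X, k.+1 * (t + p) <= y, y < k.+2 * t & y <= x].
  move=> y_s; have : y \in row (t + p) k.+1 X by rewrite def_row.
  rewrite mem_filter => /andP[/eqP div_y y_X]; split=> //.
  - by rewrite -div_y leq_trunc_div.
  - by have := core_set_lt t_gt0 coreX y_X; rewrite div_y.
  have := @sorted_row (t + p) k.+1 X sX; rewrite def_row /= => ps.
  move: y_s; rewrite inE => /predU1P[->//|y_s].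
  by have /allP/(_ y y_s)/ltnW := order_path_min gtn_trans ps.
have rowI y : y \in X -> k * (t + p) <= y -> y < k.+1 * t -> y \in row (t + p) k X.
  move=> y_X le_y lt_y; rewrite mem_filter y_X andbT eqn_leq leq_divRL // le_y andbT.
  by rewrite -ltnS ltn_divLR // mulnDr; lia.
pose s1 := [seq y - (t + p) | y <- x :: s] ++ [seq x - (t + p) + i | i <- iota 1 p].
have uniq_s1 : uniq s1.
  have uniq_row : uniq (x :: s) by rewrite -def_row sorted_gtn_uniq // sorted_row.
  rewrite cat_uniq; apply/and3P; split.
  - rewrite map_inj_in_uniq // => y z /row_facts[_ le_y _ _] /row_facts[_ le_z _ _].
    by rewrite mulSn in le_y le_z; lia.
  - apply/hasPn => z /mapP[i]; rewrite mem_iota => i_p ->.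
    by apply/negP => /mapP[y /row_facts[_ _ _ le_yx]]; lia.
  - by rewrite map_inj_uniq ?iota_uniq //; apply: addnI.
have sub_s1 : {subset s1 <= row (t + p) k X}.
  move=> y; rewrite mem_cat => /orP[] /mapP[z].
    move=> /row_facts[z_X le_z lt_z _] ->; rewrite !mulSn in le_z lt_z.
    by apply: rowI; [apply: closedX | |]; rewrite ?mulSn; lia.
  have [x_X le_x lt_x _] := row_facts x (mem_head x s).
  rewrite mem_iota => z_p ->; rewrite !mulSn in le_x lt_x.
  apply: rowI; rewrite ?mulSn; [|by lia|by lia].
  have -> : x - (t + p) + z = x - (t + (p - z)) by lia.
  by apply: closedX => //; lia.
have : size s1 <= size (row (t + p) k X) by apply: uniq_leq_size.
by rewrite size_cat !size_map size_iota; lia.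
Qed.

Lemma core_set_profile t p X : 0 < t -> core_set t p X ->
  profile t p (fun k => size (row (t + p) k X)).
Proof.
move=> t_gt0 coreX; split=> [|k]; last exact: core_set_row_shrink.
have [sX X0 _] := coreX.
suff : size (row (t + p) 0 X) <= size (iota 1 t.-1) by rewrite size_iota; lia.
apply: uniq_leq_size; first by rewrite sorted_gtn_uniq // sorted_row.
move=> x; rewrite mem_filter => /andP[/eqP div_x x_X].
have := core_set_lt t_gt0 coreX x_X; rewrite div_x mul1n mem_iota.
have : x != 0 by apply: contraNneq X0 => <-.
by lia.
Qed.

Lemma sum_rows T n (X : seq nat) (F : nat -> nat) :
  {in X, forall x, x %/ T <= n} ->
  \sum_(x <- X) F x = \sum_(k < n.+1) \sum_(x <- row T k X) F x.
Proof.
move=> row_le; under [RHS]eq_bigr do rewrite big_filter.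
rewrite (exchange_big_dep xpredT) //= big_seq [RHS]big_seq; apply: eq_bigr => x x_X.
have lt_k : x %/ T < n.+1 by rewrite ltnS row_le.
by rewrite (big_pred1 (Ordinal lt_k)) // => k /=; rewrite eq_sym -val_eqE.
Qed.

Definition right_row (t k a : nat) : seq nat := rev (iota (k.+1 * t - a) a).

(** [sumn_leq_right_interval] applies to each row; its equality case is carried along to identify
    the maximal cores. *)
Lemma core_size_le t p n la : 0 < t -> t <= p * n.+1 -> core_set t p (beta la) ->
  let row_k k := row (t + p) k (beta la) in
  let a k := size (row_k k) in
  ((sumn la)%:Z <= profile_size t n a
    ?= iff [forall k : 'I_n.+1, row_k k == right_row t k (a k)])%R.
Proof.
move=> t_gt0 le_t coreX row_k a; have [sX _ _] := coreX.
have row_le : {in beta la, forall x, x %/ (t + p) <= n}.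
  by move=> x; apply: core_set_row_le coreX.
have sizeE : size la = \sum_(k < n.+1) a k.
  rewrite -size_beta -sum1_size (sum_rows _ row_le); apply: eq_bigr => k _.
  by rewrite sum1_size.
have := sumn_beta la; rewrite sizeE sumnE (sum_rows _ row_le) => sumE.
have weightE : (\sum_(k < n.+1) row_weight t k (a k)
    = (\sum_(k < n.+1) a k * (k.+1 * t))%N%:Z - (\sum_(k < n.+1) 'C((a k).+1, 2))%N%:Z)%R.
  rewrite !(big_morph Posz PoszD (erefl _)) -[RHS]sumrB.
  by apply: eq_bigr.
have [] : \sum_(k < n.+1) (sumn (row_k k) + 'C((a k).+1, 2))
    <= \sum_(k < n.+1) a k * (k.+1 * t)
    ?= iff [forall k : 'I_n.+1, row_k k == right_row t k (a k)].
  apply: leqif_sum => k _; apply: sumn_leq_right_interval; first exact: sorted_row.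
  move=> x; rewrite mem_filter => /andP[/eqP <-]; exact: core_set_lt.
rewrite big_split /= /profile_size weightE.
have -> : \sum_(k < n.+1) sumn (row_k k) = sumn la + 'C(\sum_(k < n.+1) a k, 2).
  by rewrite -sumE; apply: eq_bigr => k _; rewrite sumnE.
move: (\sum_(k < n.+1) a k) (\sum_(k < n.+1) a k * _) (\sum_(k < n.+1) 'C(_, 2)).
by move=> S A B le_sum eq_sum; split; [|rewrite -eq_sum]; lia.
Qed.

(** * Cores realising the staircases *)

Definition staircase_set (t p n c : nat) : seq nat :=
  [seq x <- rev (iota 0 (n.+1 * (t + p)))
     | let k := x %/ (t + p) in
       (k.+1 * t <= x + staircase p c k) && (x < k.+1 * t)].

Lemma sorted_rev_iota m s : sorted gtn (rev (iota m s)).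
Proof. by rewrite rev_sorted iota_ltn_sorted. Qed.

(** Lowering row k + 1 by t + i with i <= p moves it at most p places left relative to the right end
    of its gap, and row k has p more elements than a nonempty row k + 1. Row 0 lies strictly between
    0 and t since c < t. *)
Lemma staircase_set_core t p n c : 0 < t -> c < t -> core_set t p (staircase_set t p n c).
Proof.
move=> t_gt0 lt_ct; have T_gt0 : 0 < t + p by rewrite addn_gt0 t_gt0.
split=> [||x i].
- by apply: sorted_filter; [exact: gtn_trans | exact: sorted_rev_iota].
- by rewrite mem_filter /= div0n /staircase muln0; lia.
rewrite !mem_filter !mem_rev !mem_iota /= !add0n.
move=> /andP[/andP[le_x lt_x] bound_x] le_ip le_tx.
have [le_kx lt_kx] : x %/ (t + p) * (t + p) <= x /\ x < (x %/ (t + p)).+1 * (t + p).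
  by rewrite leq_trunc_div ltn_ceil.
case: (x %/ (t + p)) => [|k] in le_x lt_x le_kx lt_kx *; first by lia.
have -> : (x - (t + i)) %/ (t + p) = k.
  apply/eqP; rewrite eqn_leq leq_divRL // -ltnS ltn_divLR //.
  by rewrite !(mulSn, mulnDr) in le_kx lt_x *; lia.
by move: le_x lt_x; rewrite /staircase !(mulSn, mulnS); lia.
Qed.

(** As c < t, a nonempty right-justified row k starts above k (t + p), so distinct rows stay in
    distinct blocks. *)
Lemma staircase_set_row t p n c k : 0 < t -> c < t -> k <= n ->
  row (t + p) k (staircase_set t p n c) = right_row t k (staircase p c k).
Proof.
move=> t_gt0 lt_ct le_kn; have T_gt0 : 0 < t + p by rewrite addn_gt0 t_gt0.
have [sX _ _] := @staircase_set_core t p n c t_gt0 lt_ct.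
apply: (irr_sorted_eq gtn_trans ltnn); [exact: sorted_row|exact: sorted_rev_iota|].
move=> x; rewrite !mem_filter !mem_rev !mem_iota /= add0n.
have le_kn' : k.+1 * (t + p) <= n.+1 * (t + p) by rewrite leq_mul2r ltnS le_kn orbT.
have le_a : staircase p c k <= k.+1 * t by rewrite /staircase mulSn; lia.
apply/and3P/idP => [[/eqP-> /andP[le_x lt_x] _]|x_row]; first by lia.
have -> : x %/ (t + p) = k.
  apply/eqP; rewrite eqn_leq leq_divRL // -ltnS ltn_divLR //.
  by move: x_row; rewrite /staircase !(mulSn, mulnDr) (mulnC p); lia.
by split; rewrite ?eqxx //; rewrite ?(mulSn, mulnDr) in le_kn' x_row le_a *; lia.
Qed.

Definition staircase_core (t p n c : nat) : seq nat := unbeta (staircase_set t p n c).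

Lemma beta_staircase_core t p n c : 0 < t -> c < t ->
  beta (staircase_core t p n c) = staircase_set t p n c.
Proof.
move=> t_gt0 lt_ct; have [sX X0 _] := @staircase_set_core t p n c t_gt0 lt_ct.
exact: unbetaK.
Qed.

Lemma staircase_core_partition t p n c : 0 < t -> c < t ->
  is_core_partition (iota t p.+1) (staircase_core t p n c).
Proof.
move=> t_gt0 lt_ct; have coreX := @staircase_set_core t p n c t_gt0 lt_ct.
apply/core_partitionP => //; rewrite beta_staircase_core //; split=> //.
by case: coreX => sX X0 _; apply: is_partition_unbeta.
Qed.

Lemma size_right_row t k a : size (right_row t k a) = a.
Proof. by rewrite size_rev size_iota. Qed.

Lemma sumn_staircase_core t p n c : 0 < t -> t <= p * n.+1 -> c < t ->
  ((sumn (staircase_core t p n c))%:Z = profile_size t n (staircase p c))%R.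
Proof.
move=> t_gt0 le_t lt_ct.
have := @core_size_le t p n (staircase_core t p n c) t_gt0 le_t.
rewrite beta_staircase_core // => /(_ (staircase_set_core _ _ t_gt0 lt_ct)) [_].
have rowE k : k <= n -> size (row (t + p) k (staircase_set t p n c)) = staircase p c k.
  by move=> le_kn; rewrite staircase_set_row // size_right_row.
rewrite (eq_profile_size t rowE) => eq_size; apply/eqP; rewrite eq_size.
by apply/forallP => k; rewrite rowE ?staircase_set_row // -ltnS.
Qed.

Lemma core_set_eq_rows t p n X Y : 0 < t -> t <= p * n.+1 ->
    core_set t p X -> core_set t p Y ->
    (forall k, k <= n -> row (t + p) k X = row (t + p) k Y) -> X = Y.
Proof.
move=> t_gt0 le_t coreX coreY eq_row; have [[sX _ _] [sY _ _]] := (coreX, coreY).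
apply: (irr_sorted_eq gtn_trans ltnn) => // x.
have sub U V : core_set t p U ->
    (forall k, k <= n -> row (t + p) k U = row (t + p) k V) ->
    x \in U -> x \in V.
  move=> coreU eq_UV x_U; have le_n := core_set_row_le t_gt0 le_t coreU x_U.
  have : x \in row (t + p) (x %/ (t + p)) U by rewrite mem_filter eqxx.
  by rewrite eq_UV // mem_filter => /andP[].
by apply/idP/idP; apply: sub => // k le_kn; rewrite eq_row.
Qed.

(** * Maximal cores are staircase cores, and their number *)

Lemma core_partition_max t p n la : 0 < t -> 0 < p -> t <= p * n.+1 ->
  is_core_partition (iota t p.+1) la ->
  exists2 c, c < t & la = staircase_core t p n c
    \/ ((sumn la)%:Z < profile_size t n (staircase p c))%R.
Proof.
move=> t_gt0 p_gt0 le_t /core_partitionP-/(_ t_gt0)[part_la coreX].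
have [le_size eq_size] := @core_size_le t p n la t_gt0 le_t coreX.
have prof := core_set_profile t_gt0 coreX.
have [] := profile_staircase t_gt0 p_gt0 le_t prof; last first.
  by move=> [c lt_ct gain]; exists c => //; right; apply: le_lt_trans gain.
set c := size _ => eq_a; exists c; first by case: prof.
have eq_prof := @eq_profile_size t n _ _ (fun k _ => eq_a k).
rewrite eq_prof in le_size eq_size.
have [eq_size_c|ne_size] :=
  eqVneq (sumn la)%:Z%R (profile_size t n (staircase p c)); last first.
  by right; rewrite lt_neqAle ne_size le_size.
(* Equal size forces every row to be right-justified; the rows determine the beta set, and the beta
   set determines the partition. *)
left; apply: beta_inj; rewrite beta_staircase_core //; last by case: prof.
rewrite eq_size_c eqxx in eq_size.
have /forallP right_rows := esym eq_size.
apply: (core_set_eq_rows t_gt0 le_t) => //.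
  by apply: staircase_set_core => //; case: prof.
move=> k le_kn; rewrite staircase_set_row //; last by case: prof.
by have /eqP := right_rows (Ordinal (le_kn : k < n.+1)); rewrite /= eq_a.
Qed.

Theorem theorem1p1 (t p n d : nat) (t_gt0 : 0 < t) (p_gt0 : 0 < p)
    (d_gt0 : 1 <= d) (d_le_p : d <= p) (def_t : t = p * n + d) :
  let ts := iota t p.+1 in
  let M : int := Num.max (max_size1 p n d) (max_size2 p n d) in
  [/\ exists2 la : seq nat, is_core_partition ts la & Posz (sumn la) = M,
      forall la : seq nat, is_core_partition ts la -> (Posz (sumn la) <= M)%R
    & exists s : seq (seq nat),
        [/\ uniq s,
            forall la : seq nat,
              la \in s <-> is_core_partition ts la /\ Posz (sumn la) = M
          & size s <= 4]].
Proof.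
move=> ts M.
have le_t : t <= p * n.+1 by rewrite def_t mulnS; lia.
have core_max la : is_core_partition ts la -> (Posz (sumn la) <= M)%R /\
    (Posz (sumn la) = M ->
     exists2 c, c \in maximisers p n d & c < t /\ la = staircase_core t p n c).
  move=> /(core_partition_max t_gt0 p_gt0 le_t)[c lt_ct].
  have [le_M eq_M] := staircase_max p_gt0 d_le_p def_t lt_ct.
  case=> [->|lt_size].
    by rewrite sumn_staircase_core //; split=> // /eq_M c_max; exists c.
  have lt_M := lt_le_trans lt_size le_M.
  by split; [exact: ltW | move=> eq_size; rewrite eq_size ltxx in lt_M].
split.
- have [c lt_ct size_c] := staircase_max_attained p_gt0 d_gt0 d_le_p def_t.
  exists (staircase_core t p n c); first exact: staircase_core_partition.
  by rewrite sumn_staircase_core.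
- by move=> la /core_max[].
(* The four candidates may coincide and, for n = 0, may miss the maximum; hence [undup] and the
   filters. *)
pose cores := [seq staircase_core t p n c | c <- maximisers p n d & c < t].
exists (undup [seq la <- cores | Posz (sumn la) == M]); split.
- exact: undup_uniq.
- move=> la; rewrite mem_undup mem_filter; split=> [/andP[/eqP eq_M /mapP[c]]|].
    by rewrite mem_filter => /andP[lt_ct _] def_la; rewrite {1}def_la; split=> //;
      apply: staircase_core_partition.
  move=> [core_la eq_M]; rewrite eq_M eqxx /=.
  have [_ /(_ eq_M)[c c_max [lt_ct ->]]] := core_max la core_la.
  by apply: map_f; rewrite mem_filter lt_ct.
apply: leq_trans (size_undup _) _; rewrite size_filter.
by apply: leq_trans (count_size _ _) _; rewrite size_map size_filter; apply: count_size.
Qed.
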